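(* Let $p$ be a prime number and let $U(u_1,\dots,u_n)$ be a polynomial with integer coefficients. The value of $U$ is divisible by $p$ for all integer values of the indeterminates $u_1,\dots,u_n$ if and only if $U$ can be written in the form $$U(u_1,\dots,u_n)=pU_0+(u_1^p-u_1)U_1+\cdots+(u_n^p-u_n)U_n,$$ where $U_0,U_1,\dots,U_n$ are polynomials in $u_1,\dots,u_n$ with integer coefficients. *)

(* Defs.v *)
From mathcomp Require Export all_boot all_order all_algebra.
From mathcomp.multinomials Require Export mpoly.

(* Main.v *)
Require Import Defs.
From mathcomp Require Import all_boot all_order all_algebra.
From mathcomp.multinomials Require Import mpoly.
From mathcomp Require Import finfield ring.
Import GRing.Theory.

Local Open Scope ring_scope.

(** If U has the displayed form, it takes values divisible by p because of
    Fermat's little theorem. The converse is Lagrange interpolation over the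
    finite field, carried out modulo the ideal J generated by p and the
    [u_i^p - u_i] ([fermat_ideal]).

    For a point a of F_p, the one-variable polynomial [1 - (X - a)^(p-1)] takes
    the value 1 at a and 0 at the other points. For a point u of F_p^n, let P_u
    be the product over i of these polynomials for [a = u_i], taken in the
    variable ['X_i] ([point_indicator]). Two congruences modulo J suffice:
    - the P_u sum to 1 ([point_indicator_partition]), because in each variable
      the indicators of the points of F_p sum to 1 in F_p[X], and the product of
      these sums expands into the sum of the P_u;
    - [f * P_u = f(u) * P_u] for every f ([point_indicator_eval]), because
      [(X - a) * (1 - (X - a)^(p-1)) = - (X^p - X)] in F_p[X], so that ['X_i]
      acts on P_u as the constant u_i.
    Hence U is congruent to the sum of the [U(u) * P_u]. If all values of U are
    divisible by p, this sum is in J, and so is U. The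
    identities in F_p[X] reach the multivariate integer polynomials by
    [fermat_ideal_eq0_mod]. *)

Definition fermat_ideal (p n : nat) (f : {mpoly int[n]}) : Prop :=
  exists (U0 : {mpoly int[n]}) (V : 'I_n -> {mpoly int[n]}),
    f = p%:Z *: U0 + \sum_(i < n) ('X_i ^+ p - 'X_i) * V i.

Lemma fermat_idealZ p n (f : {mpoly int[n]}) : fermat_ideal p n (p%:Z *: f).
Proof.
exists f, (fun=> 0); rewrite big1 ?addr0 // => i _; exact: mulr0.
Qed.

Lemma fermat_idealX p n (i : 'I_n) :
  fermat_ideal p n ('X_i ^+ p - 'X_i).
Proof.
exists 0, (fun j => (j == i)%:R); rewrite scaler0 add0r (bigD1 i) //= eqxx mulr1.
by rewrite big1 ?addr0 // => j /negPf ->; rewrite mulr0.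
Qed.

Lemma fermat_idealD p n (f g : {mpoly int[n]}) :
  fermat_ideal p n f -> fermat_ideal p n g -> fermat_ideal p n (f + g).
Proof.
move=> [f0 [V ->]] [g0 [W ->]]; exists (f0 + g0), (fun i => V i + W i).
rewrite scalerDr addrACA -big_split /=.
by congr (_ + _); apply: eq_bigr => i _; rewrite mulrDr.
Qed.

Lemma fermat_idealMl p n (g f : {mpoly int[n]}) :
  fermat_ideal p n f -> fermat_ideal p n (g * f).
Proof.
move=> [f0 [V ->]]; exists (g * f0), (fun i => g * V i).
rewrite mulrDr scalerAr mulr_sumr; congr (_ + _).
by apply: eq_bigr => i _; rewrite mulrCA.
Qed.

Lemma fermat_ideal0 p n : fermat_ideal p n 0.
Proof. by rewrite -(scaler0 _ p%:Z); apply: fermat_idealZ. Qed.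

Lemma fermat_idealN p n (f : {mpoly int[n]}) :
  fermat_ideal p n f -> fermat_ideal p n (- f).
Proof. by rewrite -mulN1r; apply: fermat_idealMl. Qed.

(** Membership of a difference in the ideal is a congruence, which is
    compatible with products. *)
Lemma fermat_ideal_prod p n (I : Type) (r : seq I) (F G : I -> {mpoly int[n]}) :
  (forall i, fermat_ideal p n (F i - G i)) ->
  fermat_ideal p n (\prod_(i <- r) F i - \prod_(i <- r) G i).
Proof.
move=> FG; apply: (big_ind2 (fun f g => fermat_ideal p n (f - g))) => //.
  by rewrite subrr; apply: fermat_ideal0.
move=> f1 g1 f2 g2 fg1 fg2.
have ->: f1 * f2 - g1 * g2 = f1 * (f2 - g2) + g2 * (f1 - g1) by ring.
by apply: fermat_idealD; apply: fermat_idealMl.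
Qed.

Lemma intr_Fp_eq0 (p : nat) (p_prime : prime p) (z : int) :
  (z%:~R == 0 :> 'F_p) = (p%:Z %| z)%Z.
Proof. by rewrite (dvdz_pcharf (pchar_Fp p_prime)). Qed.

(** An identity in F_p[X] can be used in each variable modulo the ideal: an
    integer polynomial that vanishes modulo p is a multiple of p, and stays so
    when a variable is substituted. *)
Lemma fermat_ideal_eq0_mod (p : nat) (p_prime : prime p) n (i : 'I_n)
    (q : {poly int}) :
  map_poly (intr : int -> 'F_p) q = 0 ->
  fermat_ideal p n (horner_alg ('X_i : {mpoly int[n]}) q).
Proof.
move=> q0; suff [r ->] : exists r, q = p%:Z *: r.
  by rewrite -mul_polyC rmorphM /= horner_algC mulr_algl; apply: fermat_idealZ.
exists (\poly_(k < size q) (q`_k %/ p)%Z); apply/polyP => k.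
rewrite coefZ coef_poly; case: ltnP => [_ | /(nth_default 0) ->]; last by rewrite mulr0.
rewrite mulrC divzK // -(intr_Fp_eq0 _ p_prime).
by rewrite -(coef_map (intr : int -> 'F_p)) q0 coef0.
Qed.

(** By Fermat's little theorem its values are congruent modulo p to 1 at a and to 0 at
    the other residues; a is lifted to its representative between 0 and p - 1. *)
Definition indicator_poly (p : nat) (a : 'F_p) : {poly int} :=
  1 - ('X - (a : nat)%:Z%:P) ^+ p.-1.

Lemma map_indicator_poly p (a : 'F_p) :
  map_poly (intr : int -> 'F_p) (indicator_poly p a)
  = 1 - ('X - a%:P) ^+ p.-1.
Proof.
rewrite /indicator_poly rmorphB rmorph1 rmorphXn rmorphB /= map_polyX map_polyC /=.
by rewrite -pmulrn natr_Zp.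
Qed.

Lemma expFp (p : nat) (p_prime : prime p) (a : 'F_p) : a ^+ p = a.
Proof. by rewrite -[in X in _ ^+ X](card_Fp p_prime) expf_card. Qed.

(** In characteristic p, [(X - a)^p = X^p - a^p = X^p - a]. *)
Lemma mul_indicator_poly (p : nat) (p_prime : prime p) (a : 'F_p) :
  ('X - a%:P) * (1 - ('X - a%:P) ^+ p.-1) + ('X ^+ p - 'X) = 0 :> {poly 'F_p}.
Proof.
have p_gt0 := prime_gt0 p_prime.
have pch : p \in [pchar {poly 'F_p}] by rewrite pchar_poly pchar_Fp.
rewrite mulrBr mulr1 -exprS prednK // -(pFrobenius_autE pch) pFrobenius_autB_comm.
  by rewrite !pFrobenius_autE -polyC_exp expFp //; ring.
exact: mulrC.
Qed.

(** The two sides have degree less than p and agree at the p points of the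
    field. *)
Lemma sum_indicator_poly (p : nat) (p_prime : prime p) :
  \sum_(a : 'F_p) (1 - ('X - a%:P) ^+ p.-1) = 1 :> {poly 'F_p}.
Proof.
have p_gt0 := prime_gt0 p_prime.
have size_le (a : 'F_p) : (size (1 - ('X - a%:P) ^+ p.-1)%R <= p)%N.
  rewrite (leq_trans (size_polyD _ _)) // size_polyN geq_max size_poly1 p_gt0 /=.
  by rewrite size_exp_XsubC prednK.
apply/eqP; rewrite -subr_eq0; apply/negPn/negP => q_neq0.
have := max_poly_roots (rs := enum 'F_p) q_neq0; rewrite -cardE card_Fp //.
rewrite ltnNge => /(_ _ (enum_uniq _))/negP; apply.
  apply/allP => b _; rewrite /root !hornerE horner_sum (bigD1 b) //= !hornerE.
  (* At b, only the indicator of b contributes. *)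
  rewrite subrr expr0n big1 => [|a ab].
    by rewrite -subn1 subn_eq0 leqNgt prime_gt1 //= subr0 addr0 subrr.
  rewrite !hornerE; have ba : b - a != 0 by rewrite subr_eq0 eq_sym.
  apply: (mulfI ba); rewrite mulr0 mulrBr mulr1 -exprS prednK //.
  by rewrite expFp // subrr.
rewrite (leq_trans (size_polyD _ _)) // size_polyN geq_max size_poly1 p_gt0 andbT.
by rewrite (leq_trans (size_sum _ _ _)) //; apply/bigmax_leqP.
Qed.

Definition point_indicator (p n : nat) (u : {ffun 'I_n -> 'F_p}) :
  {mpoly int[n]} :=
  \prod_(i < n) horner_alg ('X_i : {mpoly int[n]}) (indicator_poly p (u i)).

(** The sum of the products is the product over i of the sums over F_p of the
    indicators in ['X_i], and each of these sums is 1 modulo the ideal. *)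
Lemma point_indicator_partition (p : nat) (p_prime : prime p) n :
  fermat_ideal p n (1 - \sum_(u : {ffun 'I_n -> 'F_p}) point_indicator p n u).
Proof.
rewrite /point_indicator.
rewrite -(bigA_distr_bigA (fun i a => horner_alg 'X_i (indicator_poly p a))).
rewrite -[X in X - _](big1_eq (op := *%R) (index_enum 'I_n) xpredT).
apply: fermat_ideal_prod => i.
rewrite -(rmorph1 (horner_alg ('X_i : {mpoly int[n]}))) -rmorph_sum -rmorphB.
apply: fermat_ideal_eq0_mod => //.
rewrite rmorphB rmorph1 rmorph_sum /=.
under eq_bigr do rewrite map_indicator_poly.
by rewrite sum_indicator_poly // subrr.
Qed.

Lemma point_indicator_X (p : nat) (p_prime : prime p) n
    (u : {ffun 'I_n -> 'F_p}) (i : 'I_n) :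
  fermat_ideal p n (('X_i - ((u i : nat)%:Z)%:MP) * point_indicator p n u).
Proof.
rewrite /point_indicator (bigD1 i) //= mulrA mulrC; apply: fermat_idealMl.
set L := horner_alg _ _.
have -> : ('X_i - (Posz (u i : nat))%:MP) * L
    = (('X_i - (Posz (u i : nat))%:MP) * L + ('X_i ^+ p - 'X_i))
      - ('X_i ^+ p - 'X_i) by ring.
apply: fermat_idealD; last exact/fermat_idealN/fermat_idealX.
have -> : ('X_i - (Posz (u i : nat))%:MP) * L + ('X_i ^+ p - 'X_i)
  = horner_alg 'X_i (('X - (Posz (u i : nat))%:P) * indicator_poly p (u i)
                     + ('X ^+ p - 'X)).
  rewrite {}/L; move: (indicator_poly _ _) => q.
  by rewrite rmorphD rmorphM !rmorphB rmorphXn /= horner_algX horner_algC alg_mpolyC.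
apply: fermat_ideal_eq0_mod => //.
rewrite rmorphD rmorphM /= map_indicator_poly !rmorphB /=.
rewrite map_polyXn map_polyX map_polyC /=.
by rewrite -pmulrn natr_Zp mul_indicator_poly.
Qed.

(** The polynomials that act on the indicator of u as the constant equal to
    their value at u are closed under sums and products; they contain the
    constants, and the variables by [point_indicator_X]. *)
Lemma point_indicator_eval (p : nat) (p_prime : prime p) n
    (u : {ffun 'I_n -> 'F_p}) (f : {mpoly int[n]}) :
  fermat_ideal p n
    ((f - (f.@[fun i => (u i : nat)%:Z])%:MP) * point_indicator p n u).
Proof.
set v := fun i => _; set P := point_indicator p n u.
pose good g := fermat_ideal p n ((g - (g.@[v])%:MP) * P).
have goodC c : good c%:MP.
  by rewrite /good mevalC subrr mul0r; apply: fermat_ideal0.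
have goodD g h : good g -> good h -> good (g + h).
  rewrite /good => Gg Gh; rewrite mevalD mpolyCD opprD addrACA mulrDl.
  exact: fermat_idealD.
have goodM g h : good g -> good h -> good (g * h).
  rewrite /good mevalM mpolyCM; move: (_.@[_]%:MP) (_.@[_]%:MP) => b a Gg Gh.
  have -> : (g * h - a * b) * P = g * ((h - b) * P) + b * ((g - a) * P).
    by ring.
  by apply: fermat_idealD; apply: fermat_idealMl.
have goodX i : good 'X_i by rewrite /good mevalXU; apply: point_indicator_X.
have good1 : good 1 by rewrite -mpolyC1.
rewrite -/(good f) (mpolyE f); apply: (big_ind good) => // [|m _].
  by rewrite -mpolyC0; apply: goodC.
rewrite -mul_mpolyC; apply: (goodM) => //.
rewrite mpolyXE_id; apply: (big_ind good) => // i _.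
by elim: (m i) => [|k IHk]; rewrite ?expr0 // exprS; apply: goodM.
Qed.

Theorem mainTheorem10 (p : nat) (p_prime : prime p) (n : nat)
    (U : {mpoly int[n]}) :
  (forall u : 'I_n -> int, (p%:Z %| U.@[u])%Z) <->
  (exists (U0 : {mpoly int[n]}) (V : 'I_n -> {mpoly int[n]}),
     U = p%:Z *: U0 + \sum_(i < n) ('X_i ^+ p - 'X_i) * V i).
Proof.
split=> [pU | [U0 [V ->]] u].
  rewrite -/(fermat_ideal p n U).
  have -> : U = U * (1 - \sum_u point_indicator p n u)
      + \sum_u U * point_indicator p n u.
    by rewrite -mulr_sumr -mulrDr subrK mulr1.
  apply: fermat_idealD; first exact/fermat_idealMl/point_indicator_partition.
  apply: big_ind => [||u _]; [exact: fermat_ideal0 | exact: fermat_idealD |].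
  (* [U * P_u] is [(U - U(u)) * P_u + U(u) * P_u]. *)
  rewrite -[U](subrK (U.@[fun i => (u i : nat)%:Z])%:MP) mulrDl.
  apply: fermat_idealD; first exact: point_indicator_eval.
  have /dvdzP[c ->] := pU (fun i => (u i : nat)%:Z).
  by rewrite (mulrC c) mpolyCM -mulrA mul_mpolyC; apply: fermat_idealZ.
rewrite mevalD mevalZ raddf_sum /= rpredD ?dvdz_mulr ?rpred_sum // => i _.
rewrite mevalM mevalB rmorphXn /= mevalXU dvdz_mulr // -(intr_Fp_eq0 _ p_prime).
by rewrite rmorphB rmorphXn /= expFp // subrr.
Qed.
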